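(* Let $k\ge 3$ and $1\le d<k/2$ be integers. Then for integers $n$, \[ f_d^{n/k}(k,n) \le \left( g(k,d) + o(1) \right) \binom{n-d}{k-d}, \] where $o(1)$ denotes a function of $n$ (for fixed $k,d$) tending to $0$ as $n\to\infty$; equivalently, $c_{k,d}^*\le g(k,d)$, where $c_{k,d}^*:=\limsup_{n\to\infty} f_d^{n/k}(k,n)/\binom{n-d}{k-d}$ and \[ g(k,d) := 1- \left(1- \frac{(k-d)(k-2d-1)}{(k-1)^2} \right) \left( 1-\frac{1}{k} \right)^{k-d}. \]
   Context: A $k$-uniform hypergraph ($k$-graph) $H=(V,E)$ has finite vertex set $V$ and edge set $E$ a family of $k$-element subsets of $V$. For a $d$-set $S\subseteq V$, $\deg_H(S)$ is the number of edges containing $S$, and $\delta_d(H)=\min\{\deg_H(S): S\in\binom{V}{d}\}$. A fractional matching in $H$ is a function $w:E\to[0,1]$ such that $\sum_{e\in E: v\in e} w(e)\le 1$ for every $v\in V$; its size is $\sum_{e\in E}w(e)$, and it is perfect if its size is $|V|/k$. For a real $s$, $f_d^s(k,n)$ denotes the smallest integer $m$ such that every $n$-vertex $k$-graph $H$ with $\delta_d(H)\ge m$ has a fractional matching of size $s$. *)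

(* Defs.v *)
From mathcomp Require Import all_boot all_order all_algebra.
From mathcomp Require Import reals.
Set Implicit Arguments. Unset Strict Implicit. Unset Printing Implicit Defensive.
Import Order.TTheory GRing.Theory Num.Theory.
Local Open Scope ring_scope.

Definition kgraph (k n : nat) (E : {set {set 'I_n}}) : Prop :=
  forall e, e \in E -> #|e| = k.

Definition hdeg (n : nat) (E : {set {set 'I_n}}) (S : {set 'I_n}) : nat :=
  #|[set e in E | S \subset e]|.

Definition mindeg_ge (n d : nat) (E : {set {set 'I_n}}) (m : int) : Prop :=
  forall S : {set 'I_n}, #|S| = d -> m <= (hdeg E S)%:Z.

Definition frac_matching (R : realType) (n : nat) (E : {set {set 'I_n}})
    (w : {set 'I_n} -> R) : Prop :=
  (forall e, e \in E -> 0 <= w e <= 1) /\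
  (forall v : 'I_n, \sum_(e in E | v \in e) w e <= 1).

Definition fm_size (R : realType) (n : nat) (E : {set {set 'I_n}})
    (w : {set 'I_n} -> R) : R := \sum_(e in E) w e.

Definition has_fm (R : realType) (n : nat) (E : {set {set 'I_n}}) (s : R) : Prop :=
  exists w, frac_matching E w /\ fm_size E w = s.

(* P(m): every n-vertex k-graph H with delta_d(H) >= m has a fractional
   matching of size s.  f_d^s(k,n) is the smallest integer m with P(m). *)
Definition fd_good (R : realType) (d k n : nat) (s : R) (m : int) : Prop :=
  forall E : {set {set 'I_n}}, kgraph k E -> mindeg_ge d E m -> has_fm E s.

(* "f_d^s(k,n) <= x": since f is the minimum of {m | P(m)}, this holds
   iff some integer m <= x satisfies P(m). *)
Definition fd_le (R : realType) (d k n : nat) (s : R) (x : R) : Prop :=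
  exists m : int, fd_good d k n s m /\ m%:~R <= x.

Definition gkd (R : realType) (k d : nat) : R :=
  1 - (1 - ((k%:R - d%:R) * (k%:R - 2 * d%:R - 1)) / (k%:R - 1) ^+ 2)
      * (1 - 1 / k%:R) ^+ (k - d).

(* Main.v *)
Require Import Defs.
From mathcomp Require Import all_boot all_order all_algebra.
From mathcomp Require Import reals.
From mathcomp Require Import ring lra zify.
Import Order.TTheory GRing.Theory Num.Theory.
Local Open Scope ring_scope.

(* If H has no perfect fractional matching, Farkas' lemma gives a vertex
   weighting x with positive total that is nonpositive on every edge. Let S
   be the d vertices of largest weight. A suitable affine image u >= 0 of -x has
   total less than n/k and makes every edge of the link of S heavy: u(e) >= 1.
   With l = k - d it remains to bound the number of l-tuples of total weight at
   least 1 when n = sk points carry total weight less than s.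

   Let T be the s heaviest points, all of weight at least y, and B the other
   s(k - 1), all of weight at most y. Keep only the tuples with at most one entry
   in T. Writing W = u(B) and P for the proportion of (l-1)-tuples of B of weight at
   least 1 - y, the proportion of heavy l-tuples in B is at most
   l W P / (s (k-1)): weight each deletion of an entry by the deleted entry. The heavy
   tuples with one entry t in T, and P itself, are controlled by Markov's
   inequality applied to the excess over y. Optimising over W gives g(k,d). *)

(** * Counting tuples by total weight *)

Lemma sum_const_seq {R : pzSemiRingType} {I : Type} (s : seq I) (c : R) :
  \sum_(x <- s) c = (size s)%:R * c.
Proof. by rewrite big_const_seq count_predT iter_addr_0 mulr_natl. Qed.

(* The number of l-tuples of entries of [xs] with sum at least [r]; [light] counts
   those with sum less than [r]. *)
Fixpoint heavy {R : realFieldType} (xs : seq R) (l : nat) (r : R) : R :=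
  if l is l'.+1 then \sum_(x <- xs) heavy xs l' (r - x) else (r <= 0)%R%:R.

Fixpoint light {R : realFieldType} (xs : seq R) (l : nat) (r : R) : R :=
  if l is l'.+1 then \sum_(x <- xs) light xs l' (r - x) else (0 < r)%R%:R.

Lemma heavy_ge0 {R : realFieldType} (xs : seq R) l r : 0 <= heavy xs l r.
Proof. by elim: l r => [|l IH] r /=; rewrite ?ler0n// sumr_ge0. Qed.

Lemma heavy_anti {R : realFieldType} (xs : seq R) l r r' :
  r <= r' -> heavy xs l r' <= heavy xs l r.
Proof.
elim: l r r' => [|l IH] r r' rr' /=; last by apply: ler_sum => x _; apply/IH/lerB.
by case: (leP r' 0) => [r'0|_]; rewrite ?(le_trans rr' r'0)// ler0n.
Qed.

Lemma perm_heavy {R : realFieldType} (xs ys : seq R) l r :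
  perm_eq xs ys -> heavy xs l r = heavy ys l r.
Proof.
move=> xy; elim: l r => [|l IH] r //=.
by rewrite (perm_big _ xy)/=; apply: eq_bigr => x _; rewrite IH.
Qed.

Lemma heavy_catl {R : realFieldType} (xs ys : seq R) l r :
  heavy xs l r <= heavy (xs ++ ys) l r.
Proof.
elim: l r => [|l IH] r //=; rewrite big_cat /= -[leLHS]addr0 lerD//.
  exact: ler_sum.
by apply: sumr_ge0 => x _; exact: heavy_ge0.
Qed.

Lemma light_ge0 {R : realFieldType} (xs : seq R) l r : 0 <= light xs l r.
Proof. by elim: l r => [|l IH] r /=; rewrite ?ler0n// sumr_ge0. Qed.

Lemma heavyDlight {R : realFieldType} (xs : seq R) l r :
  heavy xs l r + light xs l r = (size xs)%:R ^+ l.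
Proof.
elim: l r => [|l IH] r /=; first by case: leP; rewrite ?addr0 ?add0r.
rewrite -big_split /=; under eq_bigr => x _ do rewrite IH.
by rewrite sum_const_seq exprS.
Qed.

(* The light tuples with at most one entry in [ts]. *)
Lemma light_cat {R : realFieldType} (ts bs : seq R) l r :
  light bs l r + l%:R * (\sum_(t <- ts) light bs l.-1 (r - t))
    <= light (ts ++ bs) l r.
Proof.
elim: l r => [|l IH] r; first by rewrite mul0r addr0.
rewrite /= big_cat /= [leRHS]addrC.
have h (b : R) : light bs l (r - b) +
    l%:R * (\sum_(t <- ts) light bs l.-1 (r - t - b)) <= light (ts ++ bs) l (r - b).
  apply: le_trans (IH _); rewrite lerD2l ler_wpM2l ?ler0n//.
  by apply: ler_sum => t _; rewrite addrAC.
have hB : \sum_(b <- bs) (light bs l (r - b) +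
    l%:R * (\sum_(t <- ts) light bs l.-1 (r - t - b)))
    <= \sum_(b <- bs) light (ts ++ bs) l (r - b) by exact: ler_sum.
have hT : \sum_(t <- ts) light bs l (r - t) <= \sum_(t <- ts) light (ts ++ bs) l (r - t).
  apply: ler_sum => t _; apply: le_trans (IH _); rewrite lerDl mulr_ge0//.
  by apply: sumr_ge0 => ? _; exact: light_ge0.
apply: le_trans (lerD hB hT).
rewrite big_split /= -mulr_sumr -addrA lerD2l exchange_big /=.
rewrite -natr1 mulrDl mul1r lerD2r.
by case: l {IH h hB hT} => [|l]; first by rewrite !mul0r.
Qed.

(* If an l-tuple has sum at least [r], deleting any entry leaves a sum of at
   least [r - y]; weight each deletion by the deleted entry. *)
Lemma heavy_shadow {R : realFieldType} (bs : seq R) (y : R) l r :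
  (forall b, b \in bs -> 0 <= b <= y) ->
  r * heavy bs l r <= l%:R * (\sum_(b <- bs) b) * heavy bs l.-1 (r - y).
Proof.
move=> hbs; elim: l r => [|l IH] r.
  by rewrite !mul0r /=; case: (leP r 0); rewrite ?mulr1 ?mulr0.
set W := \sum_(b <- bs) b in IH *.
(* Write [r = (r - b) + b] with [b] the first entry: [h] treats the part [r - b] by induction, and
   [h2] the part [b] by deleting that entry. *)
have h : \sum_(b <- bs) (r - b) * heavy bs l (r - b)
         <= l%:R * W * heavy bs l (r - y).
  case: l IH => [|l] IH.
    rewrite !mul0r; apply: sumr_le0 => b _ /=.
    by case: (leP (r - b) 0) => ?; rewrite ?mulr1 ?mulr0.
  rewrite /= mulr_sumr; apply: ler_sum => b _.
  by apply: le_trans (IH _) _ => /=; rewrite (_ : r - b - y = r - y - b) //; ring.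
have h2 : \sum_(b <- bs) b * heavy bs l (r - b) <= W * heavy bs l (r - y).
  rewrite mulr_suml !big_seq; apply: ler_sum => b /hbs/andP[b0 by_].
  by rewrite ler_wpM2l// heavy_anti// lerB.
rewrite -natr1 2!mulrDl mul1r; apply: le_trans (lerD h h2).
rewrite -big_split /= mulr_sumr; apply: ler_sum => b _.
by rewrite -mulrDl subrK.
Qed.

(* Markov's inequality for L - y plus the sum of j uniform entries. *)
Lemma heavy_markov {R : realFieldType} (bs : seq R) (y L : R) j :
  (forall b, b \in bs -> 0 <= b) -> y <= L -> y <= 1 ->
  (1 - y) * heavy bs j (1 - L) <=
    (size bs)%:R ^+ j * (L - y)
      + j%:R * (\sum_(b <- bs) b) * (size bs)%:R ^+ j.-1.
Proof.
move=> hbs yL y1; elim: j L yL => [|j IH] L yL.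
  rewrite !mul0r addr0 expr0 mul1r /=; case: (leP (1 - L) 0) => h; rewrite ?mulr1 ?mulr0; lra.
rewrite /= mulr_sumr.
set m := (size bs)%:R in IH *; set W := \sum_(b <- bs) b in IH *.
apply: (@le_trans _ _ (\sum_(b <- bs) (m ^+ j * (L + b - y) + j%:R * W * m ^+ j.-1))).
  rewrite !big_seq; apply: ler_sum => b /hbs b0.
  by rewrite (_ : 1 - L - b = 1 - (L + b)); [apply: IH; lra | ring].
have -> : \sum_(b <- bs) (m ^+ j * (L + b - y) + j%:R * W * m ^+ j.-1)
   = m * (m ^+ j * (L - y) + j%:R * W * m ^+ j.-1) + m ^+ j * W.
  transitivity (\sum_(b <- bs) ((m ^+ j * (L - y) + j%:R * W * m ^+ j.-1) + m ^+ j * b)).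
    by apply: eq_bigr => b _; ring.
  rewrite big_split /= -mulr_sumr; congr (_ + _).
  exact: sum_const_seq.
rewrite -natr1; case: j {IH} => [|j] /=; rewrite ?exprS; lra.
Qed.

(** * Lower bound for the light tuples *)

(** After multiplication by [1 - y], the difference of the two sides is at least [(j + 1) * p] times
    a sum of three nonnegative products. All three vanish at [y = U = 0], [W = s], the extreme case
    that fixes the constant. *)
Lemma light_arith {R : realFieldType} (s q j p y U W g h H : R) :
  0 <= s -> 0 <= q -> 0 <= j -> 0 <= p -> q <= 2 * j -> 0 <= y -> y < 1 ->
  0 <= W -> s * y <= U -> U + W < s ->
  (1 - y) * g <= j * W * p ->
  h <= (j + 1) * W * g ->
  (1 - y) * H <= s * q * p * (U - s * y) + s * (j * W * p) ->
  (q ^+ 2 - (j + 1) * (2 * j - q)) * s ^+ 2 * p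
    <= s * q * (s * q * p) - h + (j + 1) * (s * (s * q * p) - H).
Proof.
move=> s0 q0 j0 p0 qj y0 y1 W0 syU UWs hg hh hH.
have a0 : 0 < 1 - y by lra.
rewrite -(ler_pM2l a0).
have Ws : W <= s * (1 - y) by lra.
have Ws' : W <= s by have := mulr_ge0 s0 y0; lra.
have h1 : (1 - y) * h <= (j + 1) * W * (j * W * p).
  apply: (le_trans (ler_wpM2l (ltW a0) hh)).
  by rewrite mulrCA; apply: ler_wpM2l hg; rewrite mulr_ge0//; lra.
have e1 : 0 <= s * q * (s * (1 - y) - W - (U - s * y)).
  by rewrite mulr_ge0 ?mulr_ge0//; lra.
have e2 : 0 <= (2 * j - q) * s * (s * (1 - y) - W).
  by rewrite mulr_ge0 ?mulr_ge0//; lra.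
have e3 : 0 <= j * W * (s - W) by rewrite mulr_ge0 ?mulr_ge0//; lra.
have e : 0 <= (j + 1) * p * (s * q * (s * (1 - y) - W - (U - s * y))
    + (2 * j - q) * s * (s * (1 - y) - W) + j * W * (s - W)).
  by rewrite mulr_ge0 ?mulr_ge0 ?addr_ge0//.
have h2 : (1 - y) * ((j + 1) * H) <=
    (j + 1) * (s * q * p * (U - s * y) + s * (j * W * p)).
  by rewrite mulrCA ler_wpM2l// addr_ge0.
lra.
Qed.

Lemma light_lower_bound {R : realFieldType} (ts bs : seq R) (y : R) (s q j : nat) :
  (0 < j)%N -> (q <= 2 * j)%N ->
  size ts = s -> size bs = (s * q)%N ->
  (forall t, t \in ts -> y <= t) -> (forall b, b \in bs -> 0 <= b <= y) ->
  0 <= y -> \sum_(t <- ts) t + \sum_(b <- bs) b < s%:R ->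
  (q%:R ^+ 2 - j.+1%:R * (2 * j%:R - q%:R)) * s%:R ^+ 2 * (s * q)%:R ^+ j.-1
    <= light (ts ++ bs) j.+1 1.
Proof.
move=> j0 q2j sts sbs hts hbs y0 hsum.
apply: le_trans (light_cat _ _ _ _).
set U := \sum_(t <- ts) t in hsum; set W := \sum_(b <- bs) b in hsum.
have W0 : 0 <= W by rewrite /W big_seq sumr_ge0// => b /hbs/andP[].
have sy : s%:R * y <= U.
  rewrite /U -sts -sum_const_seq.
  by rewrite !big_seq; apply: ler_sum.
have sge0 : 0 <= s%:R :> R by rewrite ler0n.
(* If [y >= 1], the [s] entries of [ts] alone would have total at least [s]. *)
have y1 : y < 1 by rewrite ltNge; apply/negP => y1; have := ler_wpM2l sge0 y1; clear -hsum sy W0; lra.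
have hb0 b : b \in bs -> 0 <= b by move=> /hbs/andP[].
have msize : (size bs)%:R = s%:R * q%:R :> R by rewrite sbs natrM.
pose p : R := (s%:R * q%:R) ^+ j.-1.
have p0 : 0 <= p by rewrite exprn_ge0 ?mulr_ge0 ?ler0n.
have mj : (size bs)%:R ^+ j = s%:R * q%:R * p :> R.
  by rewrite msize -{1}(prednK j0) exprS.
set g1 := heavy bs j (1 - y).
have hg1 : (1 - y) * g1 <= j%:R * W * p.
  have := heavy_markov bs y y j hb0 (lexx _) (ltW y1).
  by rewrite subrr mulr0 add0r msize.
have hBt : heavy bs j.+1 1 <= j.+1%:R * W * g1.
  by have := heavy_shadow bs y j.+1 1 hbs; rewrite mul1r.
have hT : (1 - y) * (\sum_(t <- ts) heavy bs j (1 - t)) <=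
    s%:R * q%:R * p * (U - s%:R * y) + s%:R * (j%:R * W * p).
  rewrite mulr_sumr.
  apply: (@le_trans _ _ (\sum_(t <- ts) (s%:R * q%:R * p * (t - y) + j%:R * W * p))).
    rewrite !big_seq; apply: ler_sum => t /hts yt.
    by have := heavy_markov bs y t j hb0 yt (ltW y1); rewrite mj msize.
  by rewrite big_split /= -mulr_sumr sumrB !sum_const_seq sts.
have lB l r : light bs l r = (size bs)%:R ^+ l - heavy bs l r.
  by rewrite -(heavyDlight bs l r) addrAC subrr add0r.
rewrite lB.
under eq_bigr => t _ do rewrite lB.
rewrite sumrB sum_const_seq sts [(size bs)%:R ^+ j.+1]exprS mj msize -/p natrM -/p.
move: hT hBt hg1; set H := \sum_(t <- ts) _; set h := heavy bs _ _ => hT hBt hg1.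

rewrite -natr1 in hBt *.
apply: (light_arith s%:R q%:R j%:R p y U W g1 h H) => //; rewrite ?ler0n//.
by rewrite -natrM ler_nat.
Qed.

(** Sort by decreasing [f]. The threshold is attained at a leftover element [z], so it inherits
    properties of the entries such as nonnegativity. *)
Lemma top_split {R : realFieldType} {I : eqType} (f : I -> R) (r : seq I) (s : nat) :
  (s < size r)%N -> exists ts bs : seq I, exists z : I,
    [/\ perm_eq r (ts ++ bs), size ts = s, z \in bs,
        forall t, t \in ts -> f z <= f t & forall b, b \in bs -> f b <= f z].
Proof.
move=> sr; pose le x y := f y <= f x.
have tot : total le by move=> x y; exact: le_total.
have tr : transitive le by move=> x y z h1 h2; exact: le_trans h2 h1.
have sz : size (sort le r) = size r by rewrite size_sort.
case: r => [//|x0 r'] in sr sz *; set r := x0 :: r' in sr sz *.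
have := sort_sorted tot r; rewrite (sorted_pairwise tr) -(cat_take_drop s (sort le r)).
rewrite pairwise_cat => /and3P[/allrelP hT _].
rewrite (drop_nth x0) ?sz//= => /andP[/allP hB _].
set z := nth _ _ _ in hB; set bs := drop _ _ in hB.
exists (take s (sort le r)), (z :: bs), z; split.
- by rewrite /z /bs -drop_nth ?sz// cat_take_drop perm_sym perm_sort.
- by rewrite size_take sz sr.
- exact: mem_head.
- by move=> t /hT; apply; rewrite (drop_nth x0) ?sz// mem_head.
- by move=> b; rewrite inE => /predU1P[->//|/hB].
Qed.

(** Padding with zeros to exactly [s * q.+1] entries keeps the sum and loses no heavy tuple; then
    the light tuples are subtracted from all tuples. *)
Lemma heavy_upper_bound {R : realFieldType} (xs : seq R) (s q j : nat) :
  (0 < q)%N -> (0 < j)%N -> (q <= 2 * j)%N ->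
  (size xs <= s * q.+1)%N -> (forall x, x \in xs -> 0 <= x) ->
  \sum_(x <- xs) x < s%:R ->
  heavy xs j.+1 1 <= (s * q.+1)%:R ^+ j.+1
    - (q%:R ^+ 2 - j.+1%:R * (2 * j%:R - q%:R)) * s%:R ^+ 2 * (s * q)%:R ^+ j.-1.
Proof.
move=> q0 j0 q2j szxs xs0 sumxs.
pose ys := xs ++ nseq (s * q.+1 - size xs) 0.
apply: le_trans (heavy_catl xs (nseq (s * q.+1 - size xs) 0) j.+1 1) _; rewrite -/ys.
have szys : size ys = (s * q.+1)%N by rewrite size_cat size_nseq subnKC.
have ys0 y : y \in ys -> 0 <= y.
  by rewrite mem_cat => /orP[/xs0//|]; rewrite mem_nseq => /andP[_ /eqP->].
have sumys : \sum_(x <- ys) x < s%:R.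
  by rewrite big_cat /= [X in _ + X]big_nseq iter_addr_0 mul0rn addr0.
have s0 : (0 < s)%N.
  rewrite lt0n; apply: contraTneq sumys => ->.
  by rewrite -leNgt big_seq sumr_ge0.
have [|ts [bs [y [pe sts ybs hts hbs]]]] := top_split id ys s.
  by rewrite szys -[X in (X < _)%N]muln1 ltn_pmul2l.
have szbs : size bs = (s * q)%N.
  by have := perm_size pe; rewrite szys size_cat sts mulnS => /addnI.
have mys : ys =i ts ++ bs by exact: perm_mem.
have := light_lower_bound ts bs y s q j j0 q2j sts szbs hts.
rewrite (perm_heavy _ _ _ _ pe) -szys (perm_size pe) -(heavyDlight (ts ++ bs) _ 1).
move=> h; rewrite lerBrDr lerD2l; apply: h.
- by move=> b bbs; rewrite hbs// ys0// mys mem_cat bbs orbT.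
- by rewrite ys0// mys mem_cat ybs orbT.
- by rewrite -big_cat -(perm_big _ pe).
Qed.

(** * From tuples to vertex sets *)

Definition wsets {R : realFieldType} {T : finType} (u : T -> R) l r : {set {set T}} :=
  [set e : {set T} | (#|e| == l) && (r <= \sum_(v in e) u v)].

(** Every ordering of a heavy set is a heavy tuple. The induction double counts pairs of a set and
    its first chosen vertex [v], then deletes [v]. *)
Lemma wsets_heavy {R : realFieldType} {T : finType} (u : T -> R) l r :
  (l`! * #|wsets u l r|)%:R <= heavy [seq u v | v <- enum T] l r.
Proof.
elim: l r => [|l IH] r.
  rewrite fact0 mul1n /=.
  case: (leP r 0) => r0; rewrite ler_nat.
    apply: (@leq_trans #|[set set0 : {set T}]|); last by rewrite cards1.
    apply: subset_leq_card; by apply/subsetP => e; rewrite !inE cards_eq0 => /andP[].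
  rewrite eq_card0// => e; rewrite !inE.
  by apply/negP => /andP[]; rewrite cards_eq0 => /eqP->; rewrite big_set0 leNgt r0.
rewrite /= big_map big_enum /=.
apply: (@le_trans _ _ (\sum_(v : T) (l`! * #|wsets u l (r - u v)|)%:R)); last first.
  by apply: ler_sum => v _; exact: IH.
rewrite -natr_sum ler_nat factS -big_distrr /= (mulnC l.+1) -mulnA leq_mul2l.
apply/orP; right.
have -> : (l.+1 * #|wsets u l.+1 r| = \sum_(v : T) #|[set e in wsets u l.+1 r | v \in e]|)%N.
  rewrite mulnC -sum_nat_const.
  rewrite (eq_bigr (fun e : {set T} => \sum_(v in e) 1)%N); last first.
    by move=> e; rewrite inE => /andP[/eqP<- _]; rewrite sum1_card.
  rewrite (exchange_big_dep predT) //=; apply: eq_bigr => v _.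
  by rewrite -sum1_card; apply: eq_bigl => e; rewrite !inE.
apply: leq_sum => v _.
have inj : {in [set e in wsets u l.+1 r | v \in e] &, injective (fun e => e :\ v)}.
  move=> e1 e2; rewrite !inE => /andP[_ v1] /andP[_ v2] /= e12.
  by rewrite -(setD1K v1) -(setD1K v2) e12.
rewrite -(card_in_imset inj); apply: subset_leq_card.
apply/subsetP => _ /imsetP[e + ->]; rewrite !inE => /andP[/andP[/eqP ce re] ve].
move: ce; rewrite (cardsD1 v) ve add1n => -[->]; rewrite eqxx /=.
by move: re; rewrite (big_setD1 v ve) /= addrC lerBlDr.
Qed.

(** * Linear duality and the link of a vertex set *)

(* Bartl's induction: in the only nontrivial case, project along the separating
   vector of the previous step onto the kernel of the new functional. *)
Lemma farkas {R : realFieldType} {N : nat} {I : eqType} (r : seq I)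
    (al : I -> 'cV[R]_N) (ga : 'cV[R]_N) :
  uniq r ->
  (exists la : I -> R, (forall i, 0 <= la i) /\ ga = \sum_(i <- r) la i *: al i) \/
  (exists x : 'rV[R]_N,
     (forall i, i \in r -> (x *m al i) 0 0 <= 0) /\ 0 < (x *m ga) 0 0).
Proof.
elim: r al ga => [|i0 r IH] al ga /=.
  move=> _; have [->|ga0] := eqVneq ga 0.
    by left; exists (fun=> 0); split; rewrite ?big_nil.
  right; exists ga^T; split => //; rewrite mxE.
  have [j gaj] : exists j, ga j 0 != 0.
    by have /matrix0Pn[j [c]] := ga0; rewrite (ord1 c); exists j.
  rewrite (bigD1 j)//= ltr_pwDl//.
    by rewrite mxE -expr2 lt_neqAle eq_sym sqrf_eq0 gaj sqr_ge0.
  by apply: sumr_ge0 => i _; rewrite mxE -expr2 sqr_ge0.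
move=> /andP[i0r ur].
have ext (la : I -> R) c (be : I -> 'cV[R]_N) :
    \sum_(i <- i0 :: r) (if i == i0 then c else la i) *: be i =
    c *: be i0 + \sum_(i <- r) la i *: be i.
  rewrite big_cons eqxx !big_seq; congr (_ + _); apply: eq_bigr => i ir.
  by case: eqP => // ii0; rewrite -ii0 ir in i0r.
have [[la [la0 ->]]|[x [xal xga]]] := IH al ga ur.
  left; exists (fun i => if i == i0 then 0 else la i).
  by split; [move=> i; case: ifP | rewrite ext scale0r add0r].
have [xi0|c0] := leP ((x *m al i0) 0 0) 0.
  by right; exists x; split=> // i; rewrite inE => /predU1P[->//|/xal].
set c := _ 0 0 in c0.
pose y := c^-1 *: x.
have yE v : (y *m v) 0 0 = c^-1 * (x *m v) 0 0 by rewrite -scalemxAl mxE.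
have yi0 : (y *m al i0) 0 0 = 1 by rewrite yE mulVf// gt_eqF.
have yal i : i \in r -> (y *m al i) 0 0 <= 0.
  by move=> ir; rewrite yE pmulr_rle0 ?invr_gt0// xal.
have yga : 0 < (y *m ga) 0 0 by rewrite yE mulr_gt0 ?invr_gt0.
(* The dual view of the projection: along [al i0] onto the kernel of [y], so that
   [pr (al i0) = 0]. *)
pose pr v := v - (y *m v) 0 0 *: al i0.
have prE z v : (z *m pr v) 0 0 = (z *m v) 0 0 - (y *m v) 0 0 * (z *m al i0) 0 0.
  by rewrite mulmxBr -scalemxAr !mxE.
have [[la [la0 e]]|[z [zal zga]]] := IH (fun i => pr (al i)) (pr ga) ur.
  (* The coefficient of [al i0] restores what [pr] removed; it is nonnegative since [y] is positive
     on [ga] and nonpositive on the other [al i]. *)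
  left; exists (fun i => if i == i0
    then (y *m ga) 0 0 - \sum_(i <- r) la i * (y *m al i) 0 0 else la i).
  split.
    move=> i; case: ifP => // _; rewrite subr_ge0 (le_trans _ (ltW yga))//.
    by rewrite big_seq sumr_le0// => k kr; rewrite mulr_ge0_le0// yal.
  move/eqP: e; rewrite /pr subr_eq => /eqP {1}->; rewrite ext.
  rewrite scalerBl addrC -addrA; congr (_ + _).
  rewrite scaler_suml -sumrN -big_split /=; apply: eq_bigr => i _.
  by rewrite scalerBr scalerA addrC.
right; exists (z - (z *m al i0) 0 0 *: y).
have zE v : ((z - (z *m al i0) 0 0 *: y) *m v) 0 0 = (z *m pr v) 0 0.
  by rewrite prE mulmxBl -scalemxAl !mxE mulrC.
split; last by rewrite zE.
move=> i; rewrite inE zE => /predU1P[->|ir]; last exact: zal.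
by rewrite prE yi0 mul1r subrr.
Qed.

(** Farkas' lemma for the incidence vectors of the edges and the all-ones vector. *)
Lemma perfect_fm_or_weight {R : realFieldType} {n : nat} (E : {set {set 'I_n}}) :
  (exists w : {set 'I_n} -> R, (forall e, 0 <= w e) /\
     forall v : 'I_n, \sum_(e in E | v \in e) w e = 1) \/
  (exists x : 'I_n -> R, (forall e, e \in E -> \sum_(v in e) x v <= 0) /\
     0 < \sum_v x v).
Proof.
have [[w [w0 wE]]|[x [xE x0]]] := farkas (enum E)
    (fun e : {set 'I_n} => \col_v (v \in e)%:R : 'cV[R]_n) (const_mx 1) (enum_uniq E).
  left; exists w; split=> // v; move/matrixP/(_ v 0): wE; rewrite mxE => ->.
  rewrite summxE big_enum /= [LHS]big_mkcondr /=; apply: eq_bigr => e _.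
  by rewrite !mxE; case: (v \in e); rewrite ?mulr1 ?mulr0.
right; exists (fun v => x 0 v); split.
  move=> e; rewrite -mem_enum => /xE; rewrite mxE; congr (_ <= 0).
  rewrite [RHS]big_mkcond; apply: eq_bigr => v _.
  by rewrite mxE; case: (v \in e); rewrite ?mulr1 ?mulr0.
by move: x0; rewrite mxE; congr (0 < _); apply: eq_bigr => v _; rewrite mxE mulr1.
Qed.

(** Summing the loads over all vertices counts each edge [k] times. No edge weighs more than the
    load of a vertex in it. *)
Lemma perfect_has_fm {R : realType} {k n : nat} (E : {set {set 'I_n}}) (w : {set 'I_n} -> R) :
  (0 < k)%N -> kgraph k E -> (forall e, 0 <= w e) ->
  (forall v : 'I_n, \sum_(e in E | v \in e) w e = 1) ->
  has_fm E (n%:R / k%:R : R).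
Proof.
move=> k0 kE w0 w1; exists w; split; first split.
- move=> e eE; rewrite w0 /=.
  have /card_gt0P[v ve] : (0 < #|e|)%N by rewrite kE.
  by rewrite -(w1 v) (bigD1 e) ?eE//= lerDl sumr_ge0.
- by move=> v; rewrite w1.
apply: (mulIf (_ : k%:R != 0)); first by rewrite pnatr_eq0 -lt0n.
rewrite divfK ?pnatr_eq0 -?lt0n// /fm_size mulr_suml.
rewrite (eq_bigr (fun e : {set 'I_n} => \sum_(v in e) w e)); last first.
  by move=> e eE; rewrite sumr_const kE// mulr_natr.
rewrite (exchange_big_dep predT)//= (eq_bigr (fun=> 1)) ?sumr_const ?card_ord//.
Qed.

(* Of the weighting x only its order matters to choose S: the d heaviest
   vertices, of average weight a/d > 0. Replacing x by the deficit (a/d - x)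
   off S, normalised by k * a/d, gives a cover of the link of S. *)
Lemma link_cover {R : realFieldType} {n : nat} (E : {set {set 'I_n}}) (k d : nat)
    (x : 'I_n -> R) :
  (0 < d)%N -> (d < n)%N -> (d <= k)%N -> kgraph k E ->
  (forall e, e \in E -> \sum_(v in e) x v <= 0) -> 0 < \sum_v x v ->
  exists (S : {set 'I_n}) (u : 'I_n -> R),
    [/\ #|S| = d, forall v, 0 <= u v, \sum_v u v < n%:R / k%:R &
      forall e, e \in E -> S \subset e -> 1 <= \sum_(v in e :\: S) u v].
Proof.
move=> d0 dn dk kE xE x0.
have [|ts [bs [z [pe szt zb hts hbs]]]] := top_split x (enum 'I_n) d.
  by rewrite size_enum_ord.
have := enum_uniq 'I_n; rewrite (perm_uniq pe) cat_uniq => /and3P[ut _ _].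
pose S := [set v in ts].
have cS : #|S| = d by rewrite cardsE -szt; apply/card_uniqP.
have xS v : v \in S -> x z <= x v by rewrite inE; exact: hts.
have xnS v : v \notin S -> x v <= x z.
  rewrite inE => vt; apply: hbs.
  by have := mem_enum 'I_n v; rewrite (perm_mem pe) mem_cat (negPf vt).
clearbody S.
pose a := \sum_(v in S) x v.
have az : d%:R * x z <= a.
  by rewrite -cS mulr_natl -sumr_const; apply: ler_sum.
have sumC : \sum_(v in ~: S) x v = \sum_v x v - a.
  by rewrite [in RHS](bigID (mem S)) /= addrAC subrr add0r; apply: eq_bigl => v; rewrite inE.
have cSC : #|~: S|%:R = n%:R - d%:R :> R.
  by have /(congr1 (fun i => i%:R : R)) := cardsC S; rewrite card_ord cS natrD; lra.
have d0' : 0 < d%:R :> R by rewrite ltr0n.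
(* Either [x z > 0], and [a >= d * x z] suffices, or every vertex off [S] has weight at most 0, and
   [a] is at least the total. *)
have a0 : 0 < a.
  have [xz|xz] := ltP 0 (x z); first by apply: lt_le_trans az; exact: mulr_gt0.
  have : \sum_(v in ~: S) x v <= 0.
    by apply: sumr_le0 => v; rewrite inE => /xnS/le_trans; exact.
  by rewrite sumC; lra.
have k0 : 0 < k%:R :> R by rewrite ltr0n (leq_trans d0).
have ka0 : 0 < k%:R * a by exact: mulr_gt0.
pose u v := if v \in S then 0 else (a - d%:R * x v) / (k%:R * a).
exists S, u; split => //.
- move=> v; rewrite /u; case: ifPn => // vS; apply: divr_ge0; last exact: ltW.
  by have := ler_wpM2l (ltW d0') (xnS v vS); lra.
(* Off [S] the numerators add up to [n * a] minus [d] times the positive total of [x], whence the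
   strict inequality. *)
- rewrite (bigID (mem S)) /= big1 ?add0r; last by move=> v vS; rewrite /u vS.
  rewrite (eq_bigl (fun v => v \in ~: S)); last by move=> v; rewrite inE.
  rewrite (eq_bigr (fun v => (a - d%:R * x v) / (k%:R * a))); last first.
    by move=> v; rewrite inE /u => /negPf->.
  rewrite -mulr_suml sumrB sumr_const -mulr_sumr sumC -(mulr_natl a) cSC.
  rewrite ltr_pdivrMr// (_ : n%:R / k%:R * (k%:R * a) = n%:R * a); last first.
    by field; rewrite gt_eqF.
  by have := mulr_gt0 d0' x0; lra.
(* On [e :\: S] the numerators add up to [k * a] minus [d] times the nonpositive weight of [e]. *)
move=> e eE Se.
rewrite (eq_bigr (fun v => (a - d%:R * x v) / (k%:R * a))); last first.
  by move=> v; rewrite inE /u => /andP[/negPf->].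
have ce : #|e :\: S|%:R = k%:R - d%:R :> R.
  by rewrite cardsD (setIidPr Se) kE// cS natrB.
have xe : \sum_(v in e :\: S) x v = \sum_(v in e) x v - a.
  by rewrite [in RHS](big_setID S) /= (setIidPr Se) addrAC subrr add0r.
rewrite -mulr_suml sumrB sumr_const -mulr_sumr -(mulr_natl a) ce xe ler_pdivlMr// mul1r.
by have := ler_wpM2l (ltW d0') (xE e eE); lra.
Qed.

Lemma hdeg_wsets {R : realFieldType} {n k : nat} (E : {set {set 'I_n}}) (S : {set 'I_n})
    (u : 'I_n -> R) (r : R) :
  kgraph k E ->
  (forall e, e \in E -> S \subset e -> r <= \sum_(v in e :\: S) u v) ->
  (hdeg E S <= #|wsets u (k - #|S|) r|)%N.
Proof.
move=> kE hu; rewrite /hdeg.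
have inj : {in [set e in E | S \subset e] &, injective (fun e => e :\: S)}.
  move=> e1 e2; rewrite !inE => /andP[_ S1] /andP[_ S2] /= e12.
  by rewrite -(setID e1 S) -(setID e2 S) e12 (setIidPr S1) (setIidPr S2).
rewrite -(card_in_imset inj); apply: subset_leq_card.
apply/subsetP => _ /imsetP[e + ->]; rewrite !inE => /andP[eE Se].
by rewrite cardsD (setIidPr Se) (kE e)// eqxx hu.
Qed.

(** * The constant and the asymptotic estimates *)

Lemma gkd_ge0 {R : realType} (k d : nat) : (0 < k)%N -> (2 * d < k)%N -> 0 <= gkd R k d.
Proof.
move=> k0 dk; rewrite /gkd subr_ge0.
have k1 : 1 <= k%:R :> R by rewrite ler1n.
have dk' : 2 * d%:R + 1 <= k%:R :> R by rewrite -natrM natr1 ler_nat.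
have d0 : 0 <= d%:R :> R by rewrite ler0n.
have q0 : 0 <= 1 - 1 / k%:R :> R by rewrite subr_ge0 ler_pdivrMr ?mul1r//; lra.
have q1 : 1 - 1 / k%:R <= 1 :> R by rewrite lerBlDr lerDl divr_ge0//; lra.
apply: (@le_trans _ _ ((1 - 1 / k%:R) ^+ (k - d))); last exact: exprn_ile1.
rewrite ler_piMl ?exprn_ge0// lerBlDr lerDl divr_ge0 ?sqr_ge0 ?mulr_ge0//; lra.
Qed.

(** With [k = q + 1] and [k - d = j + 1] one has [k - 2 d - 1 = 2 j - q], so the bound on heavy
    tuples is exactly the proportion [gkd] of all tuples. *)
Lemma gkdM {R : realType} (s q j d : nat) : (0 < q)%N -> (0 < j)%N -> (j + d = q)%N ->
  (s * q.+1)%:R ^+ j.+1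
    - (q%:R ^+ 2 - j.+1%:R * (2 * j%:R - q%:R)) * s%:R ^+ 2 * (s * q)%:R ^+ j.-1
  = gkd R q.+1 d * (s * q.+1)%:R ^+ j.+1.
Proof.
move=> q0 j0 jdq; rewrite /gkd (_ : q.+1 - d = j.+1)%N; last by lia.
have -> : d%:R = q%:R - j%:R :> R by rewrite -jdq natrD addrAC subrr add0r.
rewrite [RHS]mulrBl [X in _ = X - _]mul1r; congr (_ - _).
have qq : (1 - 1 / q.+1%:R) ^+ j.+1 * (s * q.+1)%:R ^+ j.+1 = (s * q)%:R ^+ j.+1 :> R.
  rewrite -exprMn; congr (_ ^+ _); rewrite !natrM -natr1; field.
  by rewrite natr1 pnatr_eq0.
rewrite -[RHS]mulrA qq; case: j j0 {jdq qq} => // j _.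
rewrite !exprS /= expr0 !natrM -!natr1; field.
by rewrite addrK pnatr_eq0 -lt0n.
Qed.

Lemma exprD_upper {R : realFieldType} (c : R) j : 0 <= c ->
  exists K : R, 0 <= K /\
    forall x, 1 <= x -> (x + c) ^+ j.+1 <= x ^+ j.+1 + K * x ^+ j.
Proof.
move=> c0; elim: j => [|j [K [K0 IH]]].
  by exists c; split=> // x x1; rewrite !expr1 expr0 mulr1.
exists (K + c + c * K); split; first by rewrite !addr_ge0 ?mulr_ge0.
move=> x x1; rewrite exprS.
have xc : 0 <= x + c by lra.
apply: le_trans (ler_wpM2l xc (IH x x1)) _.
have xj : 0 <= x ^+ j by rewrite exprn_ge0//; lra.
have : 0 <= c * K * x ^+ j * (x - 1) by rewrite !mulr_ge0//; lra.
rewrite !exprS; lra.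
Qed.

Lemma ffact_lower (m l : nat) : ((m - l) ^ l <= m ^_ l)%N.
Proof.
elim: l m => [|l IH] [|m] //; first by rewrite sub0n exp0n.
rewrite ffactnS expnS /= subSS; apply: leq_mul; last exact: IH.
by rewrite (leq_trans (leq_subr _ _)).
Qed.

(** The slack in [m <= n + k] allows for rounding [n] up to a multiple of [k], and the added
    factorial for rounding the degree threshold. With [x = n - k] both errors are of order
    [x ^+ l.-1], which [eps * x ^+ l] absorbs once [x >= b]. *)
Lemma power_below_binomial {R : realType} (g eps : R) (k d l : nat) :
  0 <= g -> 0 < eps -> (0 < l)%N -> (d + l = k)%N ->
  exists N : nat, forall n m : nat, (N <= n)%N -> (m <= n + k)%N ->
    g * m%:R ^+ l + l`!%:R <= (g + eps) * 'C(n - d, l)%:R * l`!%:R.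
Proof.
move=> g0 e0; case: l => // j _ dlk.
have [K [K0 hK]] := exprD_upper (2 * k%:R : R) j (mulr_ge0 (ler0n _ _) (ler0n _ _)).
pose b := (g * K + j.+1`!%:R) / eps.
have b0 : 0 <= b by rewrite divr_ge0 ?addr_ge0 ?mulr_ge0 ?ler0n// ltW.
exists (k + (Num.bound b).+1)%N => n m hn hm.
pose x : R := (n - k)%:R.
have x1 : 1 <= x by rewrite ler1n; lia.
have bx : b <= x.
  by apply: le_trans (ltW (archi_boundP b0)) _; rewrite ler_nat; lia.
have mx : m%:R <= x + 2 * k%:R by rewrite -natrM -natrD ler_nat; lia.
have xC : x ^+ j.+1 <= 'C(n - d, j.+1)%:R * j.+1`!%:R.
  rewrite -natrM bin_ffact -natrX ler_nat (_ : n - k = n - d - j.+1)%N; last by lia.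
  exact: ffact_lower.
have ge0 : 0 <= g + eps by lra.
rewrite -mulrA; apply: le_trans (ler_wpM2l ge0 xC).
have xj : 1 <= x ^+ j by rewrite exprn_ege1.
have xj0 : 0 <= x ^+ j by lra.
have mj : m%:R ^+ j.+1 <= x ^+ j.+1 + K * x ^+ j.
  by apply: le_trans (hK x x1); rewrite lerXn2r// nnegrE ?ler0n//; have := ler0n R k; lra.
have ebx : g * K + j.+1`!%:R <= eps * x by rewrite [eps * x]mulrC -ler_pdivrMr.
have := ler_wpM2l g0 mj.
have := ler_wpM2r xj0 ebx.
have := ler_wpM2l (ler0n R j.+1`!) xj.
rewrite !exprS; lra.
Qed.

(** * Assembling the degree bound *)

(** The tuple bound is applied to the link cover with [s = n %/ k + 1], [q = k - 1] and
    [j = k - d - 1]; its condition [q <= 2 * j] amounts to [2 * d < k]. *)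
Lemma no_fm_hdeg {R : realType} {n : nat} (E : {set {set 'I_n}}) (k d : nat) :
  (0 < d)%N -> (2 * d < k)%N -> (k < n)%N -> kgraph k E ->
  has_fm E (n%:R / k%:R : R) \/
  exists2 S : {set 'I_n}, #|S| = d &
    ((k - d)`! * hdeg E S)%:R <= gkd R k d * ((n %/ k).+1 * k)%:R ^+ (k - d).
Proof.
move=> d0 dk kn kE.
have [[w [w0 w1]]|[x [xE x0]]] := @perfect_fm_or_weight R n E.
  by left; apply: perfect_has_fm kE w0 w1; lia.
right; have [||S [u [cS u0 su uE]]] := link_cover E k d x d0 _ _ kE xE x0; [lia..|].
exists S => //.
apply: (@le_trans _ _ (heavy [seq u v | v <- enum 'I_n] (k - d) 1)).
  apply: le_trans (wsets_heavy _ _ _); rewrite ler_nat leq_mul2l -{2}cS.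
  by rewrite hdeg_wsets ?orbT.
have := gkdM (R := R) (n %/ k).+1 k.-1 (k - d).-1 d.
rewrite !prednK; [|lia..] => <-; [|lia..].
have := heavy_upper_bound [seq u v | v <- enum 'I_n] (n %/ k).+1 k.-1 (k - d).-1.
rewrite !prednK; [|lia..]; apply; [lia..| | |].
- rewrite size_map size_enum_ord mulnC mulnS [X in (X <= _)%N](divn_eq n k) mulnC addnC.
  by rewrite leq_add2r ltnW// ltn_pmod//; lia.
- by move=> _ /mapP[v _ ->].
rewrite big_map big_enum /=; apply: lt_le_trans su _.
rewrite ler_pdivrMr ?ltr0n; last by lia.
rewrite -natrM ler_nat {1}(divn_eq n k) mulSn addnC leq_add2r ltnW// ltn_pmod//; lia.
Qed.

Theorem theorem1p5 (R : realType) (k d : nat) :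
  (3 <= k)%N -> (1 <= d)%N -> (2 * d < k)%N ->
  forall eps : R, 0 < eps ->
  exists N : nat, forall n : nat, (N <= n)%N ->
    fd_le d k n (n%:R / k%:R)
      ((gkd R k d + eps) * ('C(n - d, k - d))%:R).
Proof.
move=> k3 d1 dk eps e0.
have k0 : (0 < k)%N by lia.
have [||N hN] := power_below_binomial (gkd R k d) eps k d (k - d) (gkd_ge0 k d k0 dk) e0.
- by lia.
- by lia.
exists (N + k.+1)%N => n nN.
set x := (_ + _) * _; exists (Num.floor x); split; last exact: ge_floor.
move=> E kE degE.
have kn : (k < n)%N by lia.
have [//|[S cS hS]] := no_fm_hdeg (R := R) E k d d1 dk kn kE.
(* The degree is at least the floor of [x], so the degree plus 1 exceeds [x]; the extra factorial in
   [hx] gives the opposite inequality. *)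
have := degE S cS; rewrite -(ler_int R) => xdeg.
have := floorD1_gt x; rewrite intrD => xlt.
have Nn : (N <= n)%N by lia.
have mn : ((n %/ k).+1 * k <= n + k)%N by rewrite mulSn addnC leq_add2r leq_divM.
have := hN n _ Nn mn; rewrite -/x => hx.
have f0 : 0 < (k - d)`!%:R :> R by rewrite ltr0n fact_gt0.
have : (k - d)`!%:R * (hdeg E S)%:R + (k - d)`!%:R <= x * (k - d)`!%:R.
  by rewrite -natrM; apply: le_trans hx; rewrite lerD2r.
rewrite -{2}[(k - d)`!%:R]mulr1 -mulrDr mulrC ler_pM2r// => hle.
have : x < x by apply: lt_le_trans hle; apply: lt_le_trans xlt _; rewrite lerD2r.
by rewrite ltxx.
Qed.
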